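(* Let $\Gamma\Rightarrow\Delta$ be a sequent in the language of $\mathbf{GKMALL}$. If $\mathbf{GKMALL}\vdash\Gamma\Rightarrow\Delta$, then $\mathbf{GMALL}\vdash[\boxdot/\Box]\Gamma\Rightarrow[\boxdot/\Box]\Delta$.
   Context: Formulae of $\mathbf{GMALL}$ are built from propositional variables and constants $0,1,\bot,\top$ using the connectives $\otimes$, $\oplus$ (multiplicative disjunction, ''par''), $\land$, $\lor$ (additive conjunction and disjunction), $\neg$, $\to$. A sequent $\Gamma\Rightarrow\Delta$ is a pair of finite multisets of formulae; commas denote multiset union. The calculus $\mathbf{GMALL}$ for Multiplicative Additive Linear Logic has the following rules (no cut, weakening or contraction). Axioms: $A\Rightarrow A$; $0\Rightarrow{}$; ${}\Rightarrow 1$; $\bot,\Gamma\Rightarrow\Delta$; $\Gamma\Rightarrow\Delta,\top$. $(R0)$ from $\Gamma\Rightarrow\Delta$ infer $\Gamma\Rightarrow\Delta,0$. $(L1)$ from $\Gamma\Rightarrow\Delta$ infer $1,\Gamma\Rightarrow\Delta$. $(L\otimes)$ from $\Gamma,A,B\Rightarrow\Delta$ infer $A\otimes B,\Gamma\Rightarrow\Delta$. $(R\otimes)$ from $\Gamma\Rightarrow\Delta,A$ and $\Gamma'\Rightarrow\Delta',B$ infer $\Gamma,\Gamma'\Rightarrow\Delta,\Delta',A\otimes B$. $(L\oplus)$ from $A,\Gamma\Rightarrow\Delta$ and $B,\Gamma'\Rightarrow\Delta'$ infer $A\oplus B,\Gamma,\Gamma'\Rightarrow\Delta,\Delta'$.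 $(R\oplus)$ from $\Gamma\Rightarrow\Delta,A,B$ infer $\Gamma\Rightarrow\Delta,A\oplus B$. $(L\land_1),(L\land_2)$ from $A,\Gamma\Rightarrow\Delta$, respectively from $B,\Gamma\Rightarrow\Delta$, infer $A\land B,\Gamma\Rightarrow\Delta$. $(R\land)$ from $\Gamma\Rightarrow\Delta,A$ and $\Gamma\Rightarrow\Delta,B$ infer $\Gamma\Rightarrow\Delta,A\land B$. $(L\lor)$ from $A,\Gamma\Rightarrow\Delta$ and $B,\Gamma\Rightarrow\Delta$ infer $A\lor B,\Gamma\Rightarrow\Delta$. $(R\lor_1),(R\lor_2)$ from $\Gamma\Rightarrow\Delta,A$, respectively from $\Gamma\Rightarrow\Delta,B$, infer $\Gamma\Rightarrow\Delta,A\lor B$. $(L\neg)$ from $\Gamma\Rightarrow\Delta,A$ infer $\neg A,\Gamma\Rightarrow\Delta$. $(R\neg)$ from $A,\Gamma\Rightarrow\Delta$ infer $\Gamma\Rightarrow\Delta,\neg A$. $(L\to)$ from $\Gamma\Rightarrow\Delta,A$ and $B,\Gamma'\Rightarrow\Delta'$ infer $A\to B,\Gamma,\Gamma'\Rightarrow\Delta,\Delta'$. $(R\to)$ from $A,\Gamma\Rightarrow\Delta,B$ infer $\Gamma\Rightarrow\Delta,A\to B$. $\mathbf{GKMALL}$ is obtained by extending the language with a primitive unary connective $\Box$ and adding to $\mathbf{GMALL}$ (whose rules now apply to all formulae of the extended language) the rule $(K\Box)$: from $\Gamma\Rightarrow A$ infer $\Box\Gamma\Rightarrow\Box A$, where $\Box\Gamma$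 is the multiset obtained by prefixing each member of $\Gamma$ with $\Box$. In the language of $\mathbf{GMALL}$, the Tarskian modalities are the abbreviations $\Diamond A := \neg A\to A$ and $\boxdot A := \neg\Diamond\neg A$. $[\boxdot/\Box]\Gamma$ denotes the result of replacing every occurrence of $\Box$ in the formulae of $\Gamma$ by the defined operator $\boxdot$. *)

(* Defs.v *)
(* MathComp, with multisets from mathcomp-finmap. *)
From HB Require Import structures.
From mathcomp Require Import all_boot.
From mathcomp Require Import finmap multiset.

Set Implicit Arguments.
Unset Strict Implicit.
Unset Printing Implicit Defensive.

Local Open Scope mset_scope.

(* The two languages share one inductive type.  The boolean [b] tells whether
   the primitive [Box] is available: [Box] takes a proof of [b], so [form false]
   is the language of GMALL and [form true] that of GKMALL.
   [Zero], [One] are the multiplicative constants (units of [Par], [Tensor]);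
   [Bot], [Top] are the additive ones (units of [Or], [And]). *)
Inductive form (b : bool) : Type :=
  | Var of nat
  | Zero
  | One
  | Bot
  | Top
  | Tensor of form b & form b
  | Par of form b & form b
  | And of form b & form b
  | Or of form b & form b
  | Neg of form b
  | Imp of form b & form b
  | Box of b & form b.

Arguments Var {b} _.
Arguments Zero {b}.
Arguments One {b}.
Arguments Bot {b}.
Arguments Top {b}.

(* Encoding into [GenTree.tree nat]; it only serves to equip [form b] with the
   [choiceType] structure that [{mset form b}] requires. *)
Fixpoint form_encode (b : bool) (A : form b) : GenTree.tree nat :=
  match A with
  | Var n => GenTree.Leaf n
  | Zero => GenTree.Node 0 [::]
  | One => GenTree.Node 1 [::]
  | Bot => GenTree.Node 2 [::]
  | Top => GenTree.Node 3 [::]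
  | Tensor A B => GenTree.Node 4 [:: form_encode A; form_encode B]
  | Par A B => GenTree.Node 5 [:: form_encode A; form_encode B]
  | And A B => GenTree.Node 6 [:: form_encode A; form_encode B]
  | Or A B => GenTree.Node 7 [:: form_encode A; form_encode B]
  | Imp A B => GenTree.Node 8 [:: form_encode A; form_encode B]
  | Neg A => GenTree.Node 9 [:: form_encode A]
  | Box _ A => GenTree.Node 10 [:: form_encode A]
  end.

Fixpoint form_decode (b : bool) (t : GenTree.tree nat) : option (form b) :=
  let bin (c : form b -> form b -> form b) u v :=
    obind (fun A => omap (c A) v) u in
  match t with
  | GenTree.Leaf n => Some (Var n)
  | GenTree.Node 0 [::] => Some Zero
  | GenTree.Node 1 [::] => Some One
  | GenTree.Node 2 [::] => Some Bot
  | GenTree.Node 3 [::] => Some Top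
  | GenTree.Node 4 [:: u; v] => bin (@Tensor b) (form_decode b u) (form_decode b v)
  | GenTree.Node 5 [:: u; v] => bin (@Par b) (form_decode b u) (form_decode b v)
  | GenTree.Node 6 [:: u; v] => bin (@And b) (form_decode b u) (form_decode b v)
  | GenTree.Node 7 [:: u; v] => bin (@Or b) (form_decode b u) (form_decode b v)
  | GenTree.Node 8 [:: u; v] => bin (@Imp b) (form_decode b u) (form_decode b v)
  | GenTree.Node 9 [:: u] => omap (@Neg b) (form_decode b u)
  | GenTree.Node 10 [:: u] =>
      if b =P true is ReflectT hb then omap (Box hb) (form_decode b u) else None
  | _ => None
  end.

Lemma form_encodeK (b : bool) : pcancel (@form_encode b) (form_decode b).
Proof.
elim=> //= [A -> B ->|A -> B ->|A -> B ->|A -> B ->|A ->|A -> B ->|hb A ->] //=.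
by case: eqP => // hb'; rewrite (bool_irrelevance hb hb').
Qed.

HB.instance Definition _ (b : bool) :=
  Countable.copy (form b) (pcan_type (@form_encodeK b)).

Definition mmap (S T : choiceType) (f : S -> T) (G : {mset S}) : {mset T} :=
  seq_mset [seq f A | A <- (G : seq S)].

(* [derivable false] is GMALL and [derivable true] is GKMALL: like [Box], the
   rule [d_KBox] needs a proof of [b]. *)
Inductive derivable (b : bool) : {mset form b} -> {mset form b} -> Prop :=
  | d_Ax A : derivable [mset A] [mset A]
  | d_L0 : derivable [mset Zero] mset0
  | d_R1 : derivable mset0 [mset One]
  | d_LBot G D : derivable (Bot +` G) D
  | d_RTop G D : derivable G (D `+` [mset Top])
  | d_R0 G D : derivable G D -> derivable G (D `+` [mset Zero])
  | d_L1 G D : derivable G D -> derivable (One +` G) D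
  | d_LTensor A B G D :
      derivable (G `+` [mset A] `+` [mset B]) D -> derivable (Tensor A B +` G) D
  | d_RTensor A B G G' D D' :
      derivable G (D `+` [mset A]) -> derivable G' (D' `+` [mset B]) ->
      derivable (G `+` G') (D `+` D' `+` [mset Tensor A B])
  | d_LPar A B G G' D D' :
      derivable (A +` G) D -> derivable (B +` G') D' ->
      derivable (Par A B +` (G `+` G')) (D `+` D')
  | d_RPar A B G D :
      derivable G (D `+` [mset A] `+` [mset B]) -> derivable G (D `+` [mset Par A B])
  | d_LAnd1 A B G D : derivable (A +` G) D -> derivable (And A B +` G) D
  | d_LAnd2 A B G D : derivable (B +` G) D -> derivable (And A B +` G) D
  | d_RAnd A B G D :
      derivable G (D `+` [mset A]) -> derivable G (D `+` [mset B]) ->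
      derivable G (D `+` [mset And A B])
  | d_LOr A B G D :
      derivable (A +` G) D -> derivable (B +` G) D -> derivable (Or A B +` G) D
  | d_ROr1 A B G D : derivable G (D `+` [mset A]) -> derivable G (D `+` [mset Or A B])
  | d_ROr2 A B G D : derivable G (D `+` [mset B]) -> derivable G (D `+` [mset Or A B])
  | d_LNeg A G D : derivable G (D `+` [mset A]) -> derivable (Neg A +` G) D
  | d_RNeg A G D : derivable (A +` G) D -> derivable G (D `+` [mset Neg A])
  | d_LImp A B G G' D D' :
      derivable G (D `+` [mset A]) -> derivable (B +` G') D' ->
      derivable (Imp A B +` (G `+` G')) (D `+` D')
  | d_RImp A B G D :
      derivable (A +` G) (D `+` [mset B]) -> derivable G (D `+` [mset Imp A B])
  | d_KBox (hb : b) A G :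
      derivable G [mset A] -> derivable (mmap (Box hb) G) [mset Box hb A].

Definition GMALL (G D : {mset form false}) : Prop := derivable G D.
Definition GKMALL (G D : {mset form true}) : Prop := derivable G D.

(* The Tarskian modalities. *)
Definition tdia (A : form false) : form false := Imp (Neg A) A.
Definition tbox (A : form false) : form false := Neg (tdia (Neg A)).

Fixpoint subst_box (A : form true) : form false :=
  match A with
  | Var n => Var n
  | Zero => Zero
  | One => One
  | Bot => Bot
  | Top => Top
  | Tensor A B => Tensor (subst_box A) (subst_box B)
  | Par A B => Par (subst_box A) (subst_box B)
  | And A B => And (subst_box A) (subst_box B)
  | Or A B => Or (subst_box A) (subst_box B)
  | Neg A => Neg (subst_box A)
  | Imp A B => Imp (subst_box A) (subst_box B)
  | Box _ A => tbox (subst_box A)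
  end.

(* Main.v *)
Require Import Defs.
From mathcomp Require Import all_boot.
From mathcomp Require Import finmap multiset.

Local Open Scope mset_scope.

(** The formula [tbox A] unfolds to [Neg (Imp (Neg (Neg A)) (Neg A))], which
    behaves like [Tensor A A]: reading the rules for [Neg] and [Imp] through this
    formula, on the left it stands for two copies of [A] ([tbox_left]), and on
    the right it joins two derivations of [A] whose contexts are added
    ([tbox_right]).  The rule for [Box] is therefore simulated without cut: two
    copies of a derivation of [G => A] give [G, G => tbox A], and the two copies
    of each member of [G] are then merged into one boxed formula ([tbox_K]).
    Every other rule commutes with the substitution, because [mmap] is additive
    ([mmapD]) and [subst_box] commutes with the connectives. *)

Lemma mmap_seq_mset (S T : choiceType) (f : S -> T) (s : seq S) :
  mmap f (seq_mset s) = seq_mset (map f s).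
Proof. exact/eq_seq_msetP/perm_map/perm_eq_seq_mset. Qed.

Lemma mmap0 (S T : choiceType) (f : S -> T) : mmap f mset0 = mset0.
Proof. by apply/msetP => x; rewrite mset_seqE enum_mset0 mset0E. Qed.

Lemma mmap1 (S T : choiceType) (f : S -> T) (x : S) : mmap f [mset x] = [mset f x].
Proof.
by apply/msetP => y; rewrite mset_seqE enum_msetn msetnE /= addn0 eq_sym; case: eqP.
Qed.

Lemma seq_mset0 (V : choiceType) : seq_mset [::] = mset0 :> {mset V}.
Proof. by apply/msetP => x; rewrite mset_seqE mset0E. Qed.

Lemma seq_mset_cat (V : choiceType) (s t : seq V) :
  seq_mset (s ++ t) = seq_mset s `+` seq_mset t.
Proof. by apply/msetP => x; rewrite msetE2 !mset_seqE count_cat. Qed.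

Lemma mmapD (S T : choiceType) (f : S -> T) (G H : {mset S}) :
  mmap f (G `+` H) = mmap f G `+` mmap f H.
Proof.
by rewrite -{1}(seq_mset_id G) -{1}(seq_mset_id H) -seq_mset_cat mmap_seq_mset
  map_cat seq_mset_cat.
Qed.

Lemma mmap_comp (S T U : choiceType) (f : S -> T) (g : T -> U) (G : {mset S}) :
  mmap g (mmap f G) = mmap (g \o f) G.
Proof.
by rewrite [mmap f G]/mmap mmap_seq_mset -map_comp.
Qed.

(** The left rule of [Tensor A A], obtained by peeling off the negations: both
    copies of [A] arise on the left because [Imp] on the right releases
    [Neg (Neg A)] and [Neg A] together. *)
Lemma tbox_left (A : form false) (G D : {mset form false}) :
  GMALL (A +` (A +` G)) D -> GMALL (tbox A +` G) D.
Proof.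
move=> dA; apply: d_LNeg; apply: d_RImp; apply: d_RNeg.
by rewrite msetDCA; apply: d_LNeg; apply: d_RNeg.
Qed.

(** The right rule of [Tensor A A]: the two premises of [Imp] on the left split
    the context. *)
Lemma tbox_right (A : form false) (G G' D D' : {mset form false}) :
  GMALL G (D `+` [mset A]) -> GMALL G' (D' `+` [mset A]) ->
  GMALL (G `+` G') (D `+` D' `+` [mset tbox A]).
Proof.
move=> dA dA'; apply: d_RNeg; apply: d_LImp; last exact: d_LNeg.
by apply: d_RNeg; apply: d_LNeg.
Qed.

(** The induction on [G] needs an arbitrary extra context [H]: undoing the box on
    one member of [G] leaves its two copies in [H]. *)
Lemma tbox_left_mset (G H D : {mset form false}) :
  GMALL (H `+` (G `+` G)) D -> GMALL (H `+` mmap tbox G) D.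
Proof.
rewrite -(seq_mset_id G); elim: (G : seq _) H => [|A s IHs] H.
  by rewrite mmap_seq_mset /= seq_mset0 !msetD0.
rewrite mset_cons mmapD mmap1 => dH; rewrite msetDCA; apply: tbox_left.
rewrite !msetDA; apply: IHs; move: dH.
by rewrite msetDACA msetDCA !msetDA.
Qed.

Lemma tbox_K (A : form false) (G : {mset form false}) :
  GMALL G [mset A] -> GMALL (mmap tbox G) [mset tbox A].
Proof.
rewrite -(mset0D [mset A]) => dA.
have := tbox_right _ _ _ _ _ dA dA; rewrite !mset0D -(mset0D (G `+` G)).
by move/tbox_left_mset; rewrite mset0D.
Qed.

Theorem mainTheorem5 (G D : {mset form true}) :
  GKMALL G D -> GMALL (mmap subst_box G) (mmap subst_box D).
Proof.
rewrite /GMALL; pose mmapE := (mmapD, mmap1, mmap0).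
elim=> {G D}.
- by move=> A; rewrite !mmapE; apply: d_Ax.
- by rewrite !mmapE; apply: d_L0.
- by rewrite !mmapE; apply: d_R1.
- by move=> G D; rewrite !mmapE; apply: d_LBot.
- by move=> G D; rewrite !mmapE; apply: d_RTop.
- by move=> G D _; rewrite !mmapE; apply: d_R0.
- by move=> G D _; rewrite !mmapE; apply: d_L1.
- by move=> A B G D _; rewrite !mmapE; apply: d_LTensor.
- by move=> A B G G' D D' _ + _; rewrite !mmapE; apply: d_RTensor.
- by move=> A B G G' D D' _ + _; rewrite !mmapE; apply: d_LPar.
- by move=> A B G D _; rewrite !mmapE; apply: d_RPar.
- by move=> A B G D _; rewrite !mmapE; apply: d_LAnd1.
- by move=> A B G D _; rewrite !mmapE; apply: d_LAnd2.
- by move=> A B G D _ + _; rewrite !mmapE; apply: d_RAnd.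
- by move=> A B G D _ + _; rewrite !mmapE; apply: d_LOr.
- by move=> A B G D _; rewrite !mmapE; apply: d_ROr1.
- by move=> A B G D _; rewrite !mmapE; apply: d_ROr2.
- by move=> A G D _; rewrite !mmapE; apply: d_LNeg.
- by move=> A G D _; rewrite !mmapE; apply: d_RNeg.
- by move=> A B G G' D D' _ + _; rewrite !mmapE; apply: d_LImp.
- by move=> A B G D _; rewrite !mmapE; apply: d_RImp.
- move=> hb A G _; rewrite mmap1 mmap_comp => dA.
  (* [subst_box \o Box hb] is convertible to [tbox \o subst_box]. *)
  by have := tbox_K _ _ dA; rewrite mmap_comp mmap1.
Qed.
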